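(* Let $n\ge4$. The nonempty (and hence zero-dimensional) quiver varieties $\mathcal M_{D_n}(\mathsf v,\delta_n)$, $\mathsf v\in\mathbb N^n$, are in canonical bijection with the $D_n$ posets of type $\omega_n$. The bijection sends a $D_n$ poset $\mathcal P$ of type $\omega_n$ to the quiver variety $\mathcal M_{D_n}(\mathsf v,\delta_n)$ with $\mathsf v_i$ equal to the number of elements of $\mathcal P$ of color $i$, for $1\le i\le n$.
   Context: $\mathbb N=\{0,1,2,\dots\}$; $\delta_n=(0,\dots,0,1)\in\mathbb N^n$. The quiver $D_n$ has vertices $Q_0=\{1,\dots,n\}$ and arrows $Q_1$: $i\to i+1$ for $1\le i\le n-2$, and $n-2\to n$; an arrow $e$ goes from $o(e)$ to $i(e)$. **Quiver variety.** For $\mathsf v,\mathsf w\in\mathbb N^n$ let $V_i,W_i$ be complex vector spaces with $\dim V_i=\mathsf v_i$, $\dim W_i=\mathsf w_i$. Consider tuples $(X_e,Y_e,A_i,B_i)$ with $X_e\in\mathrm{Hom}(V_{o(e)},V_{i(e)})$, $Y_e\in\mathrm{Hom}(V_{i(e)},V_{o(e)})$, $A_i\in\mathrm{Hom}(W_i,V_i)$, $B_i\in\mathrm{Hom}(V_i,W_i)$ satisfying the moment map equations $\sum_{i(e)=i}X_eY_e-\sum_{o(e)=i}Y_eX_e+A_iB_i=0$ for all $i$. A tuple is stable if the only collection of subspaces $S_i\subset V_i$ with $\mathrm{Im}(A_i)\subset S_i$, $X_e(S_{o(e)})\subset S_{i(e)}$, $Y_e(S_{i(e)})\subset S_{o(e)}$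 is $S_i=V_i$. $\mathcal M_{D_n}(\mathsf v,\mathsf w)$ is the quotient of the set of stable tuples satisfying the moment map equations by $\prod_i GL(V_i)$ (the GIT quotient for stability parameter $(1,\dots,1)$), a smooth quasi-projective variety. **Spin poset.** The type $D_n$ spin poset has elements $d_{i,j}$ ($1\le i\le n-2$, $1\le j\le i$), $d_{n-1,j}$ ($1\le j\le\lfloor(n-1)/2\rfloor$), $d_{n,j}$ ($1\le j\le\lfloor n/2\rfloor$). Its partial order is generated by the following relations, imposed whenever both elements exist: $d_{i,j}\ge d_{i+1,j}$ and $d_{i,j}\le d_{i+1,j+1}$ for $1\le i\le n-3$, $1\le j\le i$; $d_{n-2,2j-1}\le d_{n-1,j}\le d_{n-2,2j}$ for $j\ge1$; $d_{n,j}\le d_{n-2,2j-1}$ for $j\ge1$; $d_{n-2,2j-2}\le d_{n,j}$ for $j\ge2$. The element $d_{i,j}$ has color $i$. It also carries the weight function $\mathrm{wt}(d_{i,j})=\hbar^{n-i+j-2}$ for $i\le n-2$, $\mathrm{wt}(d_{n-1,j})=\hbar^{2j-1}$, $\mathrm{wt}(d_{n,j})=\hbar^{2j-2}$. A $D_n$ poset of type $\omega_n$ is an order ideal (down-set, possibly empty) of the spin poset with the induced coloring and weights. *)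

(* Defs.v *)
From HB Require Import structures.
From mathcomp Require Import all_boot all_order all_algebra.
From mathcomp Require Import complex.
From mathcomp Require Import boolp classical_sets functions reals.

Set Implicit Arguments.
Unset Strict Implicit.
Unset Printing Implicit Defensive.

Import GRing.Theory.
Local Open Scope ring_scope.
Local Open Scope classical_set_scope.

(* The arrows e with o(e) = i and i(e) = j form the finite type [qarr i j]. *)
Record quiver := Quiver {
  qvert : finType;
  qarr : qvert -> qvert -> finType
}.

Section QuiverVariety.

Variables (F : fieldType) (Q : quiver) (v w : qvert Q -> nat).

(* V_i = F^(v i) and W_i = F^(w i) as spaces of column vectors, so that
   composition of linear maps is the matrix product in the same order. *)
Record framed_rep := FramedRep {
  repX : forall i j, qarr i j -> 'M[F]_(v j, v i);
  repY : forall i j, qarr i j -> 'M[F]_(v i, v j);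
  repA : forall i, 'M[F]_(v i, w i);
  repB : forall i, 'M[F]_(w i, v i)
}.

Implicit Type r : framed_rep.

Definition moment_map r (i : qvert Q) : 'M[F]_(v i) :=
  \sum_j \sum_(e : qarr j i) repX r e *m repY r e
  - \sum_j \sum_(e : qarr i j) repY r e *m repX r e
  + repA r i *m repB r i.

Definition stable r : Prop :=
  forall S : forall i, {vspace 'cV[F]_(v i)},
    (forall i (x : 'cV[F]_(w i)), repA r i *m x \in S i) ->
    (forall i j (e : qarr i j) x, x \in S i -> repX r e *m x \in S j) ->
    (forall i j (e : qarr i j) x, x \in S j -> repY r e *m x \in S i) ->
    forall i, S i = fullv.

Definition stable_locus : set framed_rep :=
  [set r | (forall i, moment_map r i = 0) /\ stable r].

Definition gl_act (g : forall i, 'M[F]_(v i)) r : framed_rep :=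
  FramedRep
    (fun i j e => g j *m repX r e *m invmx (g i))
    (fun i j e => g i *m repY r e *m invmx (g j))
    (fun i => g i *m repA r i)
    (fun i => repB r i *m invmx (g i)).

Definition gl_orbit r : set framed_rep :=
  [set r' | exists2 g : forall i, 'M[F]_(v i),
              forall i, g i \in unitmx & r' = gl_act g r].

(* The points of the quiver variety are the orbits themselves. *)
Definition quiver_variety : set (set framed_rep) := gl_orbit @` stable_locus.

Inductive regular_fun : (framed_rep -> F) -> Prop :=
| regular_const c : regular_fun (fun=> c)
| regular_X i j (e : qarr i j) a b : regular_fun (fun r => repX r e a b)
| regular_Y i j (e : qarr i j) a b : regular_fun (fun r => repY r e a b)
| regular_A i a b : regular_fun (fun r => repA r i a b)
| regular_B i a b : regular_fun (fun r => repB r i a b)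
| regular_add f g :
    regular_fun f -> regular_fun g -> regular_fun (fun r => f r + g r)
| regular_mul f g :
    regular_fun f -> regular_fun g -> regular_fun (fun r => f r * g r).

(* The Zariski topology of the GIT quotient: as GL acts freely on the stable
   locus, the quotient is geometric, so its topology is the quotient of the
   subspace topology of the stable locus. *)
Definition zariski_closed : set (set (set framed_rep)) :=
  [set Z | Z `<=` quiver_variety /\
    exists2 E : set (framed_rep -> F), E `<=` regular_fun &
      forall r, stable_locus r ->
        (Z (gl_orbit r) <-> forall f, E f -> f r = 0)].

End QuiverVariety.

Section KrullDimension.

Variables (T : Type) (cl : set (set T)).

Definition irreducible_closed (Z : set T) : Prop :=
  [/\ cl Z, Z !=set0 &
      forall Z1 Z2, cl Z1 -> cl Z2 -> Z `<=` Z1 `|` Z2 ->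
        Z `<=` Z1 \/ Z `<=` Z2].

Definition irreducible_chain (d : nat) : Prop :=
  exists Z : nat -> set T,
    (forall k, (k <= d)%N -> irreducible_closed (Z k)) /\
    (forall k, (k < d)%N -> Z k `<` Z k.+1).

Definition has_krull_dim (d : nat) : Prop :=
  irreducible_chain d /\ forall m, irreducible_chain m -> (m <= d)%N.

End KrullDimension.

(* The vertex labelled k in {1, ..., n} is the ordinal i with i.+1 = k; the
   predicate below is on labels. *)
Definition Dn_arrow (n i j : nat) : bool :=
  (((1 <= i <= n - 2) && (j == i.+1)) || ((i == n - 2) && (j == n)))%N.

Definition Dn (n : nat) : quiver :=
  @Quiver 'I_n (fun i j => {_ : unit | Dn_arrow n i.+1 j.+1} : finType).

Definition delta_last (n : nat) (i : 'I_n) : nat := (i.+1 == n)%N.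

Definition spin_index (n i j : nat) : bool :=
  [|| [&& 1 <= i, i <= n - 2, 1 <= j & j <= i],
      [&& i == n - 1, 1 <= j & j <= (n - 1) %/ 2] |
      [&& i == n, 1 <= j & j <= n %/ 2]]%N.

(* d_{i,j} is the pair (i, j), with i and j the labels themselves. *)
Definition spin (n : nat) : finType :=
  {d : 'I_n.+1 * 'I_n.+1 | spin_index n d.1 d.2}.

Definition spin_color (n : nat) (d : spin n) : nat := (val d).1.

(* The generating relations d_{i,j} <= d_{k,l}. *)
Definition spin_gen (n i j k l : nat) : bool :=
  [|| [&& 1 <= k <= n - 3, 1 <= l <= k, i == k.+1 & j == l],
      [&& 1 <= i <= n - 3, 1 <= j <= i, k == i.+1 & l == j.+1],
      [&& 1 <= l, i == n - 2, j == 2 * l - 1 & k == n - 1],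
      [&& 1 <= j, i == n - 1, k == n - 2 & l == 2 * j],
      [&& 1 <= j, i == n, k == n - 2 & l == 2 * j - 1] |
      [&& 2 <= l, i == n - 2, j == 2 * l - 2 & k == n]]%N.

Definition spin_le (n : nat) : rel (spin n) :=
  connect (fun d d' : spin n =>
    spin_gen n (val d).1 (val d).2 (val d').1 (val d').2).

(* The colors and weights of a type omega_n poset are restrictions of those of
   the spin poset, so such a poset is determined by its underlying ideal. *)
Definition Dn_posets (n : nat) : set {set spin n} :=
  [set P : {set spin n} | forall d d' : spin n, d \in P -> spin_le d' d -> d' \in P].

Definition color_count (n : nat) (P : {set spin n}) (i : 'I_n) : nat :=
  #|[pred d in P | spin_color d == i.+1]|.

Definition Dn_variety (R : realType) (n : nat) (v : 'I_n -> nat) :=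
  @quiver_variety R[i] (Dn n) v (@delta_last n).

Definition Dn_variety_closed (R : realType) (n : nat) (v : 'I_n -> nat) :=
  @zariski_closed R[i] (Dn n) v (@delta_last n).

Arguments Dn_variety R {n} v _ : rename.
Arguments Dn_variety_closed R {n} v _ : rename.

(* Main.v *)
Require Import Defs.
From mathcomp Require Import all_boot all_order all_algebra.
From mathcomp Require Import complex.
From mathcomp Require Import boolp classical_sets functions reals.
From mathcomp Require Import zify ring.

(* Let A : W_n -> V_n and B : V_n -> W_n be the framing maps, with W_n a line.
   For a stable solution of the moment map equations one shows B = 0. At the
   trivalent vertex let b and c be the round trips through the short legs n-1
   and n, and b + c the one through the long leg. Then b^2 = 0, c^2 has rank at
   most one (it factors through AB) and b, c, b + c are nilpotent; comparing
   (1 + zb)(1 - z(b + c))(1 + zc) for z and -z makes every linear form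
   B ... (bc)^k b ... A vanish. Given B = 0, applying to the framing vector the
   chains of arrows along covering relations yields, for each element of the
   spin poset, a vector on which every arrow acts by the corresponding cover or
   by 0. Stability says that these vectors span, and a shift operator in each
   color shows that the nonzero ones form a basis, indexed by an order ideal.
   Hence the representation is conjugate to the standard one of that ideal,
   which v determines: each nonempty variety is a single point. *)

Set Implicit Arguments.
Unset Strict Implicit.
Unset Printing Implicit Defensive.

Import GRing.Theory.
Local Open Scope ring_scope.

(** * Vanishing of alternating words *)

(** The inverse is [1 - U (1 + V U)^-1 V]. *)
Lemma unitmx_1addC (R : comUnitRingType) m p (U : 'M[R]_(m, p))
    (V : 'M[R]_(p, m)) :
  1%:M + V *m U \in unitmx -> 1%:M + U *m V \in unitmx.
Proof.
move=> hVU; set W := invmx (1%:M + V *m U).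
suff /mulmx1_unit[] : (1%:M + U *m V) *m (1%:M - U *m W *m V) = 1%:M by [].
have hW : W + V *m U *m W = 1%:M by rewrite -{1}[W]mul1mx -mulmxDl mulmxV.
rewrite mulmxBr mulmx1 mulmxDl mul1mx -[U *m W *m V]mulmxA.
have -> : U *m V *m (U *m (W *m V)) = U *m ((V *m U *m W) *m V).
  by rewrite !mulmxA.
by rewrite -mulmxDr -mulmxDl hW mul1mx addrK.
Qed.

Section Unipotent.

Variable F : fieldType.

Local Notation "M ^P" := (map_mx (@polyC F) M) (at level 8, format "M ^P").

(* Equivalent to nilpotency of [M]; this form passes from [V *m U] to [U *m V]
   without any bookkeeping of exponents. *)
Definition unip m (M : 'M[F]_m) : Prop :=
  forall z : {poly F}, 1%:M + z *: M^P \in unitmx.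

Lemma unip0 m : unip (0 : 'M[F]_m).
Proof. by move=> z; rewrite map_mx0 scaler0 addr0 unitmx1. Qed.

Lemma unipC m p (U : 'M[F]_(m, p)) (V : 'M[F]_(p, m)) :
  unip (V *m U) -> unip (U *m V).
Proof.
move=> h z; rewrite map_mxM scalemxAl; apply: unitmx_1addC.
by rewrite -scalemxAr -map_mxM.
Qed.

(** Units of [F[X]] are constants, while a nonzero [p] would give degree at least [k + 1]. *)
Lemma poly_unit_Xmul (p : {poly F}) k :
  1 + 'X^(k.+1) * p \is a GRing.unit -> p = 0.
Proof.
rewrite poly_unitE => /andP[/eqP sz _]; apply/eqP; apply: contraT => p0.
have sX : size ('X^(k.+1) * p) = (k.+1 + size p)%N.
  by rewrite mulrC size_mulXn.
have sp : (0 < size p)%N by rewrite size_poly_gt0.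
by move: sz; rewrite addrC size_polyDl ?size_poly1 sX; lia.
Qed.

(** The size is a variable [w] because the framing dimension [delta_last s] equals 1 only up to a
    proof. *)
Lemma unit11 (w : nat) (hw : w = 1%N) k (s : 'M[{poly F}]_w) :
  1%:M + 'X^(k.+1) *: s \in unitmx -> s = 0.
Proof.
subst w; rewrite unitmxE [s]mx11_scalar scale_scalar_mx -raddfD /=.
by rewrite det_scalar1 => /poly_unit_Xmul ->; rewrite raddf0.
Qed.

Section Alternating.

Hypothesis char_neq2 : 2%:R != 0 :> F.
Variables (m w : nat) (hw : w = 1%N).
Variables (b c : 'M[F]_m) (u : 'M[F]_(m, w)) (phi : 'M[F]_(w, m)).
Hypotheses (bb : b *m b = 0) (cc : c *m c = - (u *m phi)).
Hypotheses (ub : unip b) (uc : unip c) (ua : unip (b + c)).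

Let G (e : {poly F}) : 'M[{poly F}]_m :=
  (1%:M + e *: b^P) *m (1%:M + (- e) *: (b + c)^P) *m (1%:M + e *: c^P).

Lemma unitG e : G e \in unitmx.
Proof. by rewrite !unitmx_mul ub uc ua. Qed.

(** The terms linear in [e] cancel, and [bb] and [cc] reduce the rest; the only odd term left is
    [e^3 b u phi], of rank at most one. *)
Lemma GE e : G e =
  1%:M - e ^+ 2 *: (b *m c)^P + e ^+ 2 *: (u *m phi)^P
  + e ^+ 3 *: (b *m u *m phi)^P.
Proof.
rewrite /G; set B := e *: b^P; set C := e *: c^P.
have BB : B *m B = 0.
  by rewrite -scalemxAl -scalemxAr -map_mxM bb map_mx0 !scaler0.
have CC : C *m C = - (e ^+ 2 *: (u *m phi)^P).
  by rewrite -scalemxAl -scalemxAr -map_mxM cc map_mxN !scalerN scalerA -expr2.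
have -> : (- e) *: (b + c)^P = - B - C.
  by rewrite map_mxD scaleNr scalerDr opprD.
rewrite mulmxDl mul1mx !mulmxDr !mulmx1 !mulmxN BB !mulmxDl !mulNmx mul1mx.
rewrite -[B *m C *m C]mulmxA CC mulmxN.
have -> : B *m (e ^+ 2 *: (u *m phi)^P) = e ^+ 3 *: (b *m u *m phi)^P.
  by rewrite -scalemxAl -scalemxAr scalerA -exprS -map_mxM mulmxA.
have -> : B *m C = e ^+ 2 *: (b *m c)^P.
  by rewrite -scalemxAl -scalemxAr scalerA -expr2 map_mxM.
set x := _ *: _; set y := _ *: _; set t := _ *: _.
rewrite mul0mx oppr0; apply/matrixP => i j; rewrite !mxE; ring.
Qed.

(* The two sign choices [G 'X] and [G (- 'X)] are both invertible and differ by
   a rank one matrix of odd degree, which forces [phi *m y = 0]. *)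
Lemma alternating_resolvent :
  exists2 y : 'M[{poly F}]_(m, w),
    phi^P *m y = 0 & y - 'X^2 *: ((b *m c)^P *m y) = (b *m u)^P.
Proof.
pose y := invmx (G (- 'X)) *m (b *m u)^P; have phiy : phi^P *m y = 0.
  have h : 1%:M + 'X^3 *: (2%:R *: (y *m phi^P)) \in unitmx.
    have -> : 1%:M + 'X^3 *: (2%:R *: (y *m phi^P)) = invmx (G (- 'X)) *m G 'X.
      have -> : G 'X = G (- 'X) + 'X^3 *: (2%:R *: (b *m u *m phi)^P).
        rewrite !GE sqrrN exprNn -signr_odd /= expr1 mulN1r scaleNr.
        rewrite -!addrA; congr (_ + (_ + (_ + _))).
        by rewrite scalerA mulr_natr mulr2n scalerDl addKr.
      rewrite mulmxDr mulVmx ?unitG // -!scalemxAr.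
      by rewrite [(b *m u *m phi)^P]map_mxM mulmxA.
    by rewrite unitmx_mul unitmx_inv !unitG.
  (* Exchanging the two factors turns the rank one perturbation into a [w] by [w] matrix, to which
     [unit11] applies. *)
  have {h} h : 1%:M + 'X^3 *: (2%:R *: (phi^P *m y)) \in unitmx.
    move: h; rewrite !scalerA !(scalemxAl _ y) => /unitmx_1addC.
    by rewrite -scalemxAr -scalerA.
  have /matrixP h0 := unit11 hw h; apply/matrixP => i j; apply/eqP.
  have /eqP := h0 i j; rewrite !mxE mulf_eq0 => /orP[|//].
  by rewrite -polyC_natr polyC_eq0 (negPf char_neq2).
exists y => //.
(* Since [phi y = 0], only the part [1 - X^2 b c] of [G (- 'X)] acts on [y]. *)
transitivity (G (- 'X) *m y); last by rewrite mulKVmx // unitG.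
rewrite GE !mulmxDl mul1mx mulNmx -!scalemxAl !map_mxM -!mulmxA phiy.
by rewrite !mulmx0 !scaler0 !addr0 sqrrN.
Qed.

(** By the resolvent equation, [y] has [(b c)^j b u] as its coefficient of [X^(2j)], and [phi] kills
    every coefficient of [y]. *)
Lemma alternating_vanish k : phi *m iter k (mulmx (b *m c)) (b *m u) = 0.
Proof.
have [y phiy yE] := alternating_resolvent.
have Hy j : map_mx (coefp (2 * j)%N) y = iter j (mulmx (b *m c)) (b *m u).
  elim: j => [|j IHj].
    apply/matrixP => s t; have /matrixP/(_ s t) := yE.
    rewrite !mxE => /(congr1 (coefp 0)) /=.
    by rewrite coefB coefXnM /= subr0 coefC /= => <-.
  rewrite iterS -IHj; apply/matrixP => s t; have /matrixP/(_ s t) := yE.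
  rewrite !mxE => /(congr1 (coefp (2 * j.+1)%N)) /=.
  rewrite coefB coefXnM coefC mulnS /= addnC addnK => /eqP.
  rewrite subr_eq0 => /eqP ->; rewrite coef_sum; apply: eq_bigr => l _.
  by rewrite !mxE coefCM.
rewrite -Hy; apply/matrixP => s t; have /matrixP/(_ s t) := phiy.
rewrite !mxE => /(congr1 (coefp (2 * k)%N)) /=; rewrite coef0 => h0.
rewrite -[RHS]h0 coef_sum.
by apply: eq_bigr => l _; rewrite !mxE coefCM.
Qed.

End Alternating.
End Unipotent.

(** * Bases produced by a shift operator *)

Section ShiftBasis.

Variables (F : fieldType) (m : nat) (T : 'M[F]_m) (x : nat -> 'cV[F]_m).
Hypothesis Tx : forall k, T *m x k = x k.+1.

Let iterT d k : iter d (mulmx T) (x k) = x (k + d)%N.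
Proof. by elim: d => [|d IHd]; rewrite ?addn0 // iterS IHd Tx addnS. Qed.

Let iterT_sum d (I : Type) (r : seq I) (a : I -> F) (y : I -> 'cV[F]_m) :
  iter d (mulmx T) (\sum_(i <- r) a i *: y i) =
  \sum_(i <- r) a i *: iter d (mulmx T) (y i).
Proof.
elim: d => [//|d IHd]; rewrite iterS IHd mulmx_sumr.
by apply: eq_bigr => i _; rewrite -scalemxAr.
Qed.

Let eq0_ge k l : (k <= l)%N -> x k = 0 -> x l = 0.
Proof.
move=> /subnKC <- x0; elim: (l - k)%N => [|d IHd]; first by rewrite addn0.
by rewrite addnS -Tx IHd mulmx0.
Qed.

Lemma shift_free c : (forall k, (k < c)%N -> x k != 0) -> x c = 0 ->
  free (mkseq x c).
Proof.
move=> xn0 xc0.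
(* Independence is proved for the last [d] vectors, adding one at the front each time. *)
suff H d : (d <= c)%N -> free [seq x k | k <- iota (c - d) d].
  by have := H c (leqnn c); rewrite subnn.
elim: d => [|d IHd] ltdc; first by rewrite nil_free.
rewrite /= free_cons -subSn // subSS IHd ?andbT; last exact: ltnW.
set X := [seq _ | _ <- _]; apply/negP => /(@coord_span _ _ _ (in_tuple X)) xE.
(* [T^d] sends the new vector to [x (c - 1)] and all later ones to [0], so a linear relation would
   make [x (c - 1)] vanish. *)
have := xn0 c.-1; rewrite ltn_predL (leq_trans _ ltdc) // => /(_ isT)/eqP; apply.
have -> : x c.-1 = iter d (mulmx T) (x (c - d.+1)%N).
  by rewrite iterT; congr x; lia.
rewrite xE iterT_sum big1 // => i _.
have lti : (i < d)%N by apply: leq_trans (ltn_ord i) _; rewrite size_map size_iota.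
rewrite (nth_map 0%N) ?size_iota // nth_iota // iterT.
rewrite (@eq0_ge c (c - d + i + d)%N) ?scaler0 //.
by rewrite addnAC (subnK (ltnW ltdc)) leq_addr.
Qed.

(** The vectors before the first zero are free, and they span because all later ones vanish; hence
    there are exactly [m] of them. *)
Lemma shift_basis N : x N = 0 ->
  (forall S : {vspace 'cV[F]_m}, (forall k, x k \in S) -> S = fullv) ->
  (forall k, (x k == 0) = (m <= k)%N) /\
  \matrix_(i < m, j < m) x j i 0 \in unitmx.
Proof.
move=> xN full.
have ex0 : exists k, x k == 0 by exists N; apply/eqP.
case: (ex_minnP ex0) => c /eqP xc0 cmin.
have xn0 k : (k < c)%N -> x k != 0.
  by move=> ltkc; apply/negP => /cmin; rewrite leqNgt ltkc.
have fx := shift_free xn0 xc0.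
have spx : <<mkseq x c>>%VS = fullv.
  apply: full => k; have [lekc|ltck] := leqP c k.
    by rewrite (eq0_ge lekc xc0) mem0v.
  by apply/memv_span/map_f; rewrite mem_iota.
have cm : c = m.
  have /eqP := fx; rewrite size_mkseq spx => <-.
  by rewrite dimvf /dim /= muln1.
split=> [k|].
  have [lecm|ltkm] := leqP m k; first by rewrite (@eq0_ge c k) ?eqxx // cm.
  by apply/negbTE/xn0; rewrite cm.
subst c.
have sol j : exists a : 'cV[F]_m,
    (\matrix_(i < m, j < m) x j i 0) *m a = delta_mx j 0.
  have : delta_mx j 0 \in <<mkseq x m>>%VS by rewrite spx memvf.
  have sz : size (mkseq x m) == m by rewrite size_mkseq.
  move/(@coord_span _ _ _ (Tuple sz)) => dE.
  exists (\col_k coord (Tuple sz) k (delta_mx j 0)).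
  apply/colP => i; rewrite [in RHS]dE !mxE summxE; apply: eq_bigr => k _.
  by rewrite !mxE /= nth_mkseq ?ltn_ord // mulrC.
have /choice[f fP] := sol.
suff /mulmx1_unit[] : (\matrix_(i < m, j < m) x j i 0) *m
    (\matrix_(i, j) f j i 0) = 1%:M by [].
apply/matrixP => i j; have /colP/(_ i) := fP j; rewrite !mxE eqxx andbT => <-.
by apply: eq_bigr => k _; rewrite !mxE.
Qed.

End ShiftBasis.

(** * Combinatorics of the spin poset *)

Local Ltac split_ifs :=
  repeat match goal with |- context [if ?b then _ else _] =>
    lazymatch b with
    | context [if _ then _ else _] => fail
    | _ => case: (boolP b) => ?
    end
  end.

Section Combinatorics.

Variable n : nat.
Hypothesis hn : (4 <= n)%N.
Local Open Scope nat_scope.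

Definition adj (i j : nat) : bool :=
  Dn_arrow n i.+1 j.+1 || Dn_arrow n j.+1 i.+1.

(* Vertices are numbered from 0 here (and poset levels [k] from 1): along the
   arrow between adjacent [i] and [j], the poset element [d_{i+1,k}] is sent to
   the [d_{j+1,l}] covering it, [l = tgt i j k], with [l = 0] if there is none;
   [l] may also exceed the number of elements of color [j+1]. *)
Definition tgt (i j k : nat) : nat :=
  if j == n - 2 then (if odd k then k.+1./2 else 0)
  else if j == n - 1 then (if odd k then 0 else k./2.+1)
  else if i == n - 2 then k.*2
  else if i == n - 1 then k.*2.-1
  else if i < j then k.+1 else k.

(** Together with [pred_level], this selects for each element other than [d_{n,1}] one element that
    it covers. *)
Definition pred_vertex (i k : nat) : nat :=
  if i < n - 3 then i.+1
  else if i == n - 3 then (if odd k then n - 1 else n - 2)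
  else n - 3.

Definition pred_level (i k : nat) : nat :=
  if i < n - 3 then k
  else if i == n - 3 then (if odd k then k.+1./2 else k./2)
  else if i == n - 2 then k.*2.-1 else k.*2.-2.

(** The rank function of the spin poset, with [d_{n,1}] in rank 0. *)
Definition rank (i k : nat) : nat :=
  if i <= n - 3 then n - 3 - i + k.*2.-1
  else if i == n - 2 then 4 * k - 2 else 4 * k - 4.

Lemma rank0 i k : i < n -> 0 < k -> rank i k = 0 -> i = n - 1 /\ k = 1.
Proof. rewrite /rank; case: ifP; [|case: eqP]; lia. Qed.

Lemma predP i k : i < n -> 0 < k -> 0 < rank i k ->
  [/\ pred_vertex i k < n, 0 < pred_level i k,
      rank i k = (rank (pred_vertex i k) (pred_level i k)).+1,
      adj (pred_vertex i k) i & tgt (pred_vertex i k) i (pred_level i k) = k].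
Proof.
move=> ltin k0; rewrite /pred_vertex /pred_level /adj /Dn_arrow /tgt /rank.
by move=> rk0; split; move: rk0; split_ifs; lia.
Qed.

(** The six kinds of oriented edges; [Q] and [S] stand for the short leg vertices [n - 2] and
    [n - 1]. *)
Variant adj_spec (i j : nat) : Prop :=
| AdjDown of i = j.+1 & i <= n - 3 & forall k, tgt i j k = k
| AdjUp of j = i.+1 & j <= n - 3 & forall k, tgt i j k = k.+1
| AdjToQ of i = n - 3 & j = n - 2 &
    forall k, tgt i j k = if odd k then k.+1./2 else 0
| AdjOfQ of i = n - 2 & j = n - 3 & forall k, tgt i j k = k.*2
| AdjToS of i = n - 3 & j = n - 1 &
    forall k, tgt i j k = if odd k then 0 else k./2.+1
| AdjOfS of i = n - 1 & j = n - 3 & forall k, tgt i j k = k.*2.-1.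

Lemma adjP i j : i < n -> j < n -> adj i j -> adj_spec i j.
Proof.
rewrite /adj /Dn_arrow => ltin ltjn aij.
have [ej|nj] := eqVneq j (n - 2).
  by apply: AdjToQ => // [|k]; [lia|rewrite /tgt ej eqxx].
have [ej|nj1] := eqVneq j (n - 1).
  by apply: AdjToS => // [|k]; [lia|rewrite /tgt (negPf nj) ej eqxx].
have [ei|ni] := eqVneq i (n - 2).
  apply: AdjOfQ => // [|k]; first lia.
  by rewrite /tgt (negPf nj) (negPf nj1) ei eqxx.
have [ei|ni1] := eqVneq i (n - 1).
  apply: AdjOfS => // [|k]; first lia.
  by rewrite /tgt (negPf nj) (negPf nj1) (negPf ni) ei eqxx.
have E k : tgt i j k = if i < j then k.+1 else k.
  by rewrite /tgt (negPf nj) (negPf nj1) (negPf ni) (negPf ni1).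
have [ltij|leji] := ltnP i j.
  by apply: AdjUp => [||k]; [lia|lia|rewrite E ltij].
by apply: AdjDown => [||k]; [lia|lia|rewrite E ltnNge leji].
Qed.

Lemma spin_indexP i k : i < n -> spin_index n i.+1 k ->
  0 < k /\ k <= (if i <= n - 3 then i.+1
                 else if i == n - 2 then (n - 1) %/ 2 else n %/ 2).
Proof.
by rewrite /spin_index => ltin /or3P[]h; (split; first lia); split_ifs; lia.
Qed.

Lemma spin_indexI i k : i < n -> 0 < k ->
  k <= (if i <= n - 3 then i.+1
        else if i == n - 2 then (n - 1) %/ 2 else n %/ 2) ->
  spin_index n i.+1 k.
Proof.
rewrite /spin_index => ltin k0; case: ifP => [li|li].
  by move=> h; apply/or3P/Or31; lia.
by case: eqP => ei h; apply/or3P; [apply: Or32|apply: Or33]; lia.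
Qed.

(** Together with [spin_gen_tgt], this identifies the generating relations with the graph of [tgt].
    The range of the source follows from that of the target by comparing the bounds of
    [spin_indexP]. *)
Lemma tgt_gen i j k : i < n -> j < n -> adj i j -> 0 < k ->
  spin_index n j.+1 (tgt i j k) ->
  spin_index n i.+1 k /\ spin_gen n i.+1 k j.+1 (tgt i j k).
Proof.
move=> ltin ltjn aij k0 /(spin_indexP ltjn)[].
have hi := @spin_indexI i k ltin k0.
case: (adjP ltin ltjn aij) => ei ej ->.
- move=> _ h; split; first by apply: hi; move: h; split_ifs; lia.
  by apply/orP; left; move: h; split_ifs; lia.
- move=> _ h; split; first by apply: hi; move: h; split_ifs; lia.
  by apply/orP; right; apply/orP; left; move: h; split_ifs; lia.
- case: ifP => // ok _ h; split; first by apply: hi; move: h; split_ifs; lia.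
  by do 2!(apply/orP; right); apply/orP; left; lia.
- move=> _ h; split; first by apply: hi; move: h; split_ifs; lia.
  by do 3!(apply/orP; right); apply/orP; left; lia.
- case: ifP => // ok _ h; split; first by apply: hi; move: h; split_ifs; lia.
  by do 5!(apply/orP; right); lia.
- move=> _ h; split; first by apply: hi; move: h; split_ifs; lia.
  by do 4!(apply/orP; right); apply/orP; left; lia.
Qed.

Lemma spin_gen_tgt i j k l : i < n -> j < n ->
  spin_index n i.+1 k -> spin_index n j.+1 l ->
  spin_gen n i.+1 k j.+1 l -> adj i j /\ l = tgt i j k.
Proof.
move=> ltin ltjn /(spin_indexP ltin)[k0 _] /(spin_indexP ltjn)[l0 _] h.
have aij : adj i j.
  by case/or4P: h => [|||/or3P[]]; rewrite /adj /Dn_arrow; lia.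
split=> //; case: (adjP ltin ltjn aij) h => ei ej ->.
all: case/or4P => [|||/or3P[]]; split_ifs; lia.
Qed.

End Combinatorics.

(** * Moment map equations on the double quiver *)

Section ArrowSums.

Variables (V : nmodType) (n : nat) (i j : 'I_n).

Lemma sum_arrow (f : qarr (q := Dn n) i j -> V) e : \sum_e' f e' = f e.
Proof.
have all_e e' : e' = e by apply: val_inj; case: (val e'); case: (val e).
by rewrite (bigD1 e) //= big1 ?addr0 // => e'; rewrite [e']all_e eqxx.
Qed.

Lemma sum_no_arrow (f : qarr (q := Dn n) i j -> V) :
  ~~ Dn_arrow n i.+1 j.+1 -> \sum_e f e = 0.
Proof. by move=> /negP no; rewrite big1 // => -[e he]; case: (no he). Qed.

End ArrowSums.

Lemma Dn_arrow_ltn n i j : Dn_arrow n i.+1 j.+1 -> (i < j)%N.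
Proof. rewrite /Dn_arrow; lia. Qed.

Section DoubleQuiver.

Variables (F : fieldType) (n : nat) (v : 'I_n -> nat).
Local Notation rep := (@framed_rep F (Dn n) v (@delta_last n)).
Variable r : rep.

(* Two vertices are joined by at most one arrow, so at most one term occurs. *)
Definition dmap (i j : 'I_n) : 'M[F]_(v j, v i) :=
  \sum_(e : qarr (q := Dn n) i j) repX r e
  + \sum_(e : qarr (q := Dn n) j i) repY r e.

Lemma dmapX (i j : 'I_n) (e : qarr (q := Dn n) i j) : dmap i j = repX r e.
Proof.
rewrite /dmap (sum_arrow _ e) sum_no_arrow ?addr0 //.
by case: e => -[]/= /Dn_arrow_ltn lij; apply/negP => /Dn_arrow_ltn; lia.
Qed.

Lemma dmapY (i j : 'I_n) (e : qarr (q := Dn n) i j) : dmap j i = repY r e.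
Proof.
rewrite /dmap (sum_arrow _ e) sum_no_arrow ?add0r //.
by case: e => -[]/= /Dn_arrow_ltn lij; apply/negP => /Dn_arrow_ltn; lia.
Qed.

Definition loop (i j : 'I_n) : 'M[F]_(v i) := dmap j i *m dmap i j.

Lemma moment_mapE (i : 'I_n) : moment_map r i =
  \sum_(j : 'I_n | Dn_arrow n j.+1 i.+1) loop i j
  - \sum_(j : 'I_n | Dn_arrow n i.+1 j.+1) loop i j + repA r i *m repB r i.
Proof.
rewrite /moment_map; congr (_ - _ + _).
all: rewrite [RHS]big_mkcond; apply: eq_bigr => j _; case: ifPn => a.
- pose e : qarr (q := Dn n) j i := exist _ tt a.
  by rewrite (sum_arrow _ e) /loop (dmapX e) (dmapY e).
- by rewrite sum_no_arrow.
- pose e : qarr (q := Dn n) i j := exist _ tt a.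
  by rewrite (sum_arrow _ e) /loop (dmapX e) (dmapY e).
- by rewrite sum_no_arrow.
Qed.

Lemma stable_dmapP : stable r <->
  forall S : forall i, {vspace 'cV[F]_(v i)},
    (forall i x, repA r i *m x \in S i) ->
    (forall (i j : 'I_n) x, adj n i j -> x \in S i -> dmap i j *m x \in S j) ->
    forall i, S i = fullv.
Proof.
split=> st S SA.
  move=> SZ; apply: st => // i j e x xS.
    by rewrite -dmapX SZ //; case: e => -[]/= a; rewrite /adj a.
  by rewrite -dmapY SZ //; case: e => -[]/= a; rewrite /adj a orbT.
move=> SX SY; apply: st => // i j x aij xS.
case/orP: aij => a.
  pose e : qarr (q := Dn n) i j := exist _ tt a.
  by rewrite (dmapX e) SX.
pose e : qarr (q := Dn n) j i := exist _ tt a.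
by rewrite (dmapY e) SY.
Qed.

Lemma framing0 (i : 'I_n) k (M : 'M[F]_(k, delta_last i)) : i.+1 != n -> M = 0.
Proof.
move=> ni; apply/matrixP => a b; suff : (b < 0)%N by [].
by apply: leq_trans (ltn_ord b) _; rewrite /delta_last (negPf ni).
Qed.

Lemma repAB0 (i : 'I_n) : i.+1 != n -> repA r i *m repB r i = 0.
Proof. by move=> ni; rewrite [repA r i]framing0 // mul0mx. Qed.

(** * The moment map equations vertex by vertex *)

Section MomentEquations.

Hypothesis hn : (4 <= n)%N.
Hypothesis mom0 : forall i, moment_map r i = 0.

Lemma loop_first (i j : 'I_n) : i = 0 :> nat -> j = 1%N :> nat -> loop i j = 0.
Proof.
move=> ei ej; have := mom0 i; rewrite moment_mapE repAB0; last lia.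
rewrite addr0 big_pred0; last by move=> k /=; rewrite /Dn_arrow; lia.
rewrite (big_pred1 j) => [|k]; last by rewrite /= -val_eqE /= /Dn_arrow; lia.
by rewrite sub0r => /eqP; rewrite oppr_eq0 => /eqP.
Qed.

Lemma loop_leg (i h j : 'I_n) : i = h.+1 :> nat -> j = i.+1 :> nat ->
  (j <= n - 3)%N -> loop i j = loop i h.
Proof.
move=> ei ej lj; have := mom0 i; rewrite moment_mapE repAB0; last lia.
rewrite addr0 (big_pred1 h) => [|k]; last first.
  by rewrite /= -val_eqE /= /Dn_arrow; lia.
rewrite (big_pred1 j) => [|k]; last by rewrite /= -val_eqE /= /Dn_arrow; lia.
by move/eqP; rewrite subr_eq0 => /eqP.
Qed.

Lemma loop_branch (h p q s : 'I_n) : p = h.+1 :> nat -> p = (n - 3)%N :> nat ->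
  q = (n - 2)%N :> nat -> s = (n - 1)%N :> nat ->
  loop p h = loop p q + loop p s.
Proof.
move=> eh ep qE es; have := mom0 p; rewrite moment_mapE repAB0; last lia.
rewrite addr0 (big_pred1 h) => [|k]; last first.
  by rewrite /= -val_eqE /= /Dn_arrow; lia.
rewrite (bigD1 q) /=; last by rewrite /Dn_arrow; lia.
rewrite (big_pred1 s) => [|k]; last by rewrite /= -!val_eqE /= /Dn_arrow; lia.
by move/eqP; rewrite subr_eq0 => /eqP.
Qed.

Lemma loop_short (p q : 'I_n) : p = (n - 3)%N :> nat -> q = (n - 2)%N :> nat ->
  loop q p = 0.
Proof.
move=> ep qE; have := mom0 q; rewrite moment_mapE repAB0; last lia.
rewrite addr0 (big_pred1 p) => [|k]; last first.
  by rewrite /= -val_eqE /= /Dn_arrow; lia.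
rewrite big_pred0 ?subr0 // => k /=; rewrite /Dn_arrow; lia.
Qed.

Lemma loop_framed (p s : 'I_n) : p = (n - 3)%N :> nat -> s = (n - 1)%N :> nat ->
  loop s p = - (repA r s *m repB r s).
Proof.
move=> ep es; have := mom0 s; rewrite moment_mapE.
rewrite (big_pred1 p) => [|k]; last by rewrite /= -val_eqE /= /Dn_arrow; lia.
rewrite big_pred0 ?subr0 => [/eqP|k /=]; last by rewrite /Dn_arrow; lia.
by rewrite addr_eq0 => /eqP.
Qed.

Lemma framing1 (s : 'I_n) : s = (n - 1)%N :> nat -> delta_last s = 1%N.
Proof. by move=> es; rewrite /delta_last; have -> : s.+1 == n by lia. Qed.

(* Commutators are traceless, so only the framing term survives in the total
   trace of the moment map. *)
Lemma repBA0 (s : 'I_n) : s = (n - 1)%N :> nat -> repB r s *m repA r s = 0.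
Proof.
move=> es; have : \sum_i \tr (moment_map r i) = 0.
  by rewrite big1 // => i _; rewrite mom0 mxtrace0.
have -> : \sum_i \tr (moment_map r i) = \sum_(i : 'I_n)
    (\sum_(j : 'I_n | Dn_arrow n j.+1 i.+1) \tr (loop i j)
     - \sum_(j : 'I_n | Dn_arrow n i.+1 j.+1) \tr (loop i j)
     + \tr (repA r i *m repB r i)).
  apply: eq_bigr => i _; rewrite moment_mapE mxtraceD.
  by congr (_ + _); rewrite raddfB; congr (_ - _); apply: raddf_sum.
rewrite big_split sumrB /=.
have -> : \sum_(i : 'I_n) \sum_(j : 'I_n | Dn_arrow n j.+1 i.+1) \tr (loop i j)
    = \sum_(i : 'I_n) \sum_(j : 'I_n | Dn_arrow n i.+1 j.+1) \tr (loop i j).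
  rewrite (exchange_big_dep predT) //=.
  apply: eq_bigr => i _; apply: eq_bigr => j _.
  exact: mxtrace_mulC.
rewrite subrr add0r (bigD1 s) //= big1 => [|i ne]; last first.
  rewrite repAB0 ?mxtrace0 //; move: ne (ltn_ord i); rewrite -val_eqE /=; lia.
rewrite addr0 mxtrace_mulC.
(* For a 1 by 1 matrix, zero trace means zero. *)
move: (repB r s *m repA r s); rewrite (framing1 es) => M.
by rewrite [M]mx11_scalar mxtrace_scalar mulr1n => ->; rewrite raddf0.
Qed.

End MomentEquations.
End DoubleQuiver.

(** * Vectors attached to the elements of the spin poset *)

Section Generators.

Variables (F : fieldType) (n : nat) (v : 'I_n -> nat).
Variable r : @framed_rep F (Dn n) v (@delta_last n).

(** The rank serves as [d], which makes the recursion structural; by [predP], the default of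
    [insubd] is then never reached for [k >= 1]. *)
Fixpoint gen_rec (d : nat) (i : 'I_n) (k : nat) : 'cV[F]_(v i) :=
  if d is d'.+1 then
    let j := insubd i (pred_vertex n i k) in
    dmap r j i *m gen_rec d' j (pred_level n i k)
  else repA r i *m const_mx 1.

(* The image of the framing vector along a chain of the spin poset from its
   least element [d_{n,1}] up to [d_{i+1,k}]. *)
Definition gen (i : 'I_n) (k : nat) : 'cV[F]_(v i) :=
  if k is 0%N then 0 else gen_rec (rank n i k) i k.
Arguments gen : simpl never.

Hypothesis hn : (4 <= n)%N.

Lemma gen_pred (i j : 'I_n) k : (0 < k)%N -> (0 < rank n i k)%N ->
  j = pred_vertex n i k :> nat ->
  gen i k = dmap r j i *m gen j (pred_level n i k).
Proof.
move=> k0 rk0 ej; have [pvn pl0 rkE _ _] := predP hn (ltn_ord i) k0 rk0.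
have -> : j = insubd i (pred_vertex n i k).
  by apply: val_inj; rewrite val_insubd pvn.
rewrite /gen; case: k k0 rk0 ej pl0 rkE pvn => // k _ _ _ pl0 -> pvn /=.
by case: pred_level pl0 => // l _; rewrite val_insubd pvn.
Qed.

Variable s : 'I_n.
Hypothesis es : s = (n - 1)%N :> nat.

Lemma gen_s1 : gen s 1 = repA r s *m const_mx 1.
Proof.
suff rk : rank n s 1 = 0%N by rewrite /gen rk.
by rewrite /rank es; case: ifP => [|_]; [|case: eqP]; lia.
Qed.

Variables p q : 'I_n.
Hypotheses (ep : p = (n - 3)%N :> nat) (qE : q = (n - 2)%N :> nat).

Lemma gen_leg (i j : 'I_n) k : j = i.+1 :> nat -> (j <= n - 3)%N ->
  gen i k = dmap r j i *m gen j k.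
Proof.
move=> ej lj; case: k => [|k]; first by rewrite mulmx0.
have li : (i < n - 3)%N by lia.
rewrite (@gen_pred i j) /pred_level /pred_vertex /rank ?li //.
by rewrite (ltnW li); lia.
Qed.

Lemma gen_q k : gen q k = dmap r p q *m gen p k.*2.-1.
Proof.
case: k => [|k]; first by rewrite mulmx0.
have h1 : (q < n - 3)%N = false by lia.
have h2 : (q == n - 3 :> nat)%N = false by lia.
have h3 : (q == n - 2 :> nat)%N by lia.
rewrite (@gen_pred q p) /pred_level /pred_vertex ?h1 ?h2 ?h3 //.
by rewrite /rank h3; case: ifP; lia.
Qed.

Lemma gen_s k : (1 < k)%N -> gen s k = dmap r p s *m gen p k.*2.-2.
Proof.
move=> k1.
have h1 : (s < n - 3)%N = false by lia.
have h2 : (s == n - 3 :> nat)%N = false by lia.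
have h3 : (s == n - 2 :> nat)%N = false by lia.
rewrite (@gen_pred s p) /pred_level /pred_vertex ?h1 ?h2 ?h3 //.
  by lia.
by rewrite /rank h3; case: ifP; lia.
Qed.

Lemma gen_p k : (0 < k)%N -> gen p k =
  if odd k then dmap r s p *m gen s k.+1./2 else dmap r q p *m gen q k./2.
Proof.
move=> k0; have rk0 : (0 < rank n p k)%N by rewrite /rank; case: ifP; lia.
have h1 : (p < n - 3)%N = false by lia.
have h2 : (p == n - 3 :> nat)%N by lia.
case: ifP => ok.
  by rewrite (@gen_pred p s) /pred_level /pred_vertex ?h1 ?h2 ?ok.
by rewrite (@gen_pred p q) /pred_level /pred_vertex ?h1 ?h2 ?ok.
Qed.

Hypothesis mom0 : forall i, moment_map r i = 0.

(** At the end of the long leg the round trip is [0]. Exchanging factors preserves [unip], and the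
    moment map equation passes on to the next vertex. *)
Lemma unip_leg (i h : 'I_n) : i = h.+1 :> nat -> (i <= n - 3)%N ->
  unip (loop r i h).
Proof.
move: {2}(h : nat) (erefl (h : nat)) => t.
elim: t i h => [|t IHt] i h eh ei li; apply: unipC.
  by rewrite -/(loop r h i) (loop_first hn mom0) //; [exact: unip0|lia].
have lt_tn : (t < n)%N by have := ltn_ord h; lia.
rewrite -/(loop r h i) (@loop_leg _ _ _ _ hn mom0 h (Ordinal lt_tn)) //.
by apply: IHt => //=; lia.
Qed.

Let b := loop r p q.
Let c := loop r p s.

Let bb : b *m b = 0.
Proof.
rewrite /b /loop -mulmxA [X in _ *m X]mulmxA -/(loop r q p).
by rewrite (loop_short hn mom0) // mul0mx mulmx0.
Qed.

Let cc : c *m c = - (dmap r s p *m repA r s *m (repB r s *m dmap r p s)).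
Proof.
rewrite /c /loop -mulmxA [X in _ *m X]mulmxA -/(loop r s p).
by rewrite (loop_framed hn mom0 ep) // mulNmx mulmxN !mulmxA.
Qed.

Lemma unip_b : unip b.
Proof. by apply: unipC; rewrite -/(loop r q p) loop_short //; apply: unip0. Qed.

(** Exchanging factors twice reduces the claim to [B A = 0]. *)
Lemma unip_c : unip c.
Proof.
apply: unipC; rewrite -/(loop r s p) (loop_framed hn mom0 ep) // -mulNmx.
by apply: unipC; rewrite mulmxN repBA0 // oppr0; apply: unip0.
Qed.

Let h_exists : {h : 'I_n | p = h.+1 :> nat}.
Proof.
have lt_h : (n - 4 < n)%N by lia.
by exists (Ordinal lt_h) => /=; lia.
Qed.

Lemma unip_bc : unip (b + c).
Proof.
have [h ph] := h_exists.
by rewrite /b /c -(loop_branch hn mom0 ph) //; apply: unip_leg => //; lia.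
Qed.

Lemma gen_p_odd k : odd k -> gen p k.+1 = b *m gen p k.
Proof.
move=> ok; rewrite gen_p //= ok /= gen_q mulmxA /b /loop; congr (_ *m gen p _).
lia.
Qed.

Lemma gen_p_even k : (0 < k)%N -> ~~ odd k -> gen p k.+1 = c *m gen p k.
Proof.
move=> k0 ok; rewrite gen_p //= ok gen_s; last lia.
rewrite mulmxA /c /loop; congr (_ *m gen p _); lia.
Qed.

(** At [p], odd levels are raised by [b] and even ones by [c], which gives the alternating words of
    [alternating_vanish]. *)
Lemma gen_p_iter k : gen p k.*2.+2 =
  iter k (mulmx (b *m c)) (b *m (dmap r s p *m repA r s)) *m const_mx 1.
Proof.
elim: k => [|k IHk].
  rewrite gen_p_odd // gen_p //= gen_s1 !mulmxA //.
rewrite doubleS gen_p_odd /=; last by rewrite odd_double.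
rewrite gen_p_even //=; last by rewrite odd_double.
by rewrite IHk !mulmxA.
Qed.

Hypothesis char_neq2 : 2%:R != 0 :> F.

(** On level 1 this is [B A = 0]. A higher level is the image of an even level at [p], so
    [alternating_vanish] applies with [phi] equal to [B] after [dmap r p s]. *)
Lemma repB_gen k : repB r s *m gen s k = 0.
Proof.
case: k => [|[|k]]; first by rewrite mulmx0.
  by rewrite gen_s1 mulmxA repBA0 // mul0mx.
rewrite gen_s // !doubleS /= gen_p_iter mulmxA mulmxA.
rewrite (alternating_vanish char_neq2 (framing1 hn es) bb cc) ?mul0mx //.
- exact: unip_b.
- exact: unip_c.
- exact: unip_bc.
Qed.

Lemma dmap_pq_even k : ~~ odd k -> dmap r p q *m gen p k = 0.
Proof.
case: k => [|k] ok; first by rewrite mulmx0.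
rewrite gen_p // (negPf ok) mulmxA -/(loop r q p) loop_short //.
by rewrite mul0mx.
Qed.

(** The vector comes from [s], where the moment map equation leaves only the framing term, killed by
    [repB_gen]. *)
Lemma dmap_ps_odd k : odd k -> dmap r p s *m gen p k = 0.
Proof.
case: k => // k ok.
rewrite gen_p // ok mulmxA -/(loop r s p) (loop_framed hn mom0 ep) //.
by rewrite mulNmx -mulmxA repB_gen mulmx0 oppr0.
Qed.

Lemma loop_gen_p (h : 'I_n) k : p = h.+1 :> nat -> (0 < k)%N ->
  loop r p h *m gen p k = gen p k.+1.
Proof.
move=> ph k0; rewrite (loop_branch hn mom0 ph ep qE es) mulmxDl.
have [ok|ok] := boolP (odd k).
  rewrite gen_p_odd // -[RHS]addr0; congr (_ + _).
  by rewrite /loop -mulmxA dmap_ps_odd // mulmx0.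
rewrite gen_p_even // -[RHS]add0r; congr (_ + _).
by rewrite /loop -mulmxA dmap_pq_even // mulmx0.
Qed.

(** Induction on the distance to the branch vertex: [gen i k] comes from [j], so the composite is a
    round trip at [j], equal to the one through the next vertex. *)
Lemma dmap_up (i j : 'I_n) k : j = i.+1 :> nat -> (j <= n - 3)%N ->
  (0 < k)%N -> dmap r i j *m gen i k = gen j k.+1.
Proof.
move: {2}(n - 3 - j)%N (erefl (n - 3 - j)%N) => t.
elim: t i j => [|t IHt] i j et ej lj k0; rewrite (@gen_leg i j) // mulmxA.
  have ej' : j = p by apply: val_inj; rewrite /= ep; lia.
  by rewrite -/(loop r j i) ej' loop_gen_p // -ej'.
have lt_jn : (j.+1 < n)%N by lia.
rewrite -/(loop r j i) -(@loop_leg _ _ _ _ hn mom0 j i (Ordinal lt_jn)) //=; last lia.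
rewrite /loop -mulmxA IHt //=; try lia.
by rewrite -gen_leg //=; lia.
Qed.

(** For the covers chosen by [pred_vertex] this is the construction of [gen]; the other cases rest
    on the moment map equations. *)
Lemma dmap_gen (i j : 'I_n) k : adj n i j -> (0 < k)%N ->
  dmap r i j *m gen i k = gen j (tgt n i j k).
Proof.
move=> aij k0; case: (adjP hn (ltn_ord i) (ltn_ord j) aij) => ei ej ->.
- by rewrite -gen_leg.
- exact: dmap_up.
- have -> : i = p by apply: val_inj; rewrite /= ep.
  have -> : j = q by apply: val_inj; rewrite /= qE.
  case: ifPn => ok; last exact: dmap_pq_even.
  by rewrite gen_q; congr (_ *m gen p _); lia.
- have -> : i = q by apply: val_inj; rewrite /= qE.
  have -> : j = p by apply: val_inj; rewrite /= ep.
  by rewrite [gen p _]gen_p ?double_gt0 // odd_double doubleK.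
- have -> : i = p by apply: val_inj; rewrite /= ep.
  have -> : j = s by apply: val_inj; rewrite /= es.
  case: ifPn => ok; first exact: dmap_ps_odd.
  by rewrite gen_s; [congr (_ *m gen p _); lia|lia].
- have -> : i = s by apply: val_inj; rewrite /= es.
  have -> : j = p by apply: val_inj; rewrite /= ep.
  rewrite [gen p _]gen_p; last lia.
  have -> : odd k.*2.-1 by lia.
  by congr (_ *m gen s _); lia.
Qed.

(** At the end vertex the next level is the image of a vanishing round trip; [dmap_up] carries the
    vanishing along the leg. *)
Lemma gen_leg_ge (i : 'I_n) k : (i <= n - 3)%N -> (i.+1 < k)%N -> gen i k = 0.
Proof.
move: {2}(i : nat) (erefl (i : nat)) => t.
elim: t i k => [|t IHt] i [|k] et li lk //.
  have lt1 : (1 < n)%N by lia.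
  rewrite (@gen_leg i (Ordinal lt1)) //=; [|lia|lia].
  rewrite -(@dmap_up i) //=; [|lia|lia|lia].
  by rewrite mulmxA -/(loop r i (Ordinal lt1)) (loop_first hn mom0) // mul0mx.
have lt_tn : (t < n)%N by have := ltn_ord i; lia.
by rewrite -(@dmap_up (Ordinal lt_tn)) //=; [rewrite IHt ?mulmx0 //=; lia|lia].
Qed.

Lemma gen_invalid (i : 'I_n) k : ~~ spin_index n i.+1 k -> gen i k = 0.
Proof.
move=> inv; case: k inv => [//|k] inv.
have nle := contraNN (@spin_indexI n hn i k.+1 (ltn_ord i) isT) inv.
move: nle; case: ifP => li; first by rewrite -ltnNge => /gen_leg_ge ->.
case: eqP => ei.
  have -> : i = q by apply: val_inj; rewrite /= qE.
  move=> nle; rewrite gen_q gen_leg_ge ?mulmx0 //; lia.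
have -> : i = s by apply: val_inj; rewrite /= es; have := ltn_ord i; lia.
move=> nle; rewrite gen_s; last lia.
by rewrite gen_leg_ge ?mulmx0 //; lia.
Qed.

Let tgt_qp k : tgt n q p k = k.*2.
Proof. by rewrite /tgt; split_ifs; lia. Qed.

Let tgt_sp k : tgt n s p k = k.*2.-1.
Proof. by rewrite /tgt; split_ifs; lia. Qed.

(** On the long leg a round trip through a neighbour does it; on a short leg one goes to the branch
    vertex, makes the round trip along the long leg there and returns. *)
Lemma gen_shift (i : 'I_n) : exists T : 'M[F]_(v i),
  forall k, (0 < k)%N -> T *m gen i k = gen i k.+1.
Proof.
have [h ph] := h_exists.
have Tp k : (0 < k)%N -> loop r p h *m gen p k = gen p k.+1.
  exact: loop_gen_p.
have [li|li] := ltnP i (n - 3).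
  have lt_n : (i.+1 < n)%N by lia.
  exists (loop r i (Ordinal lt_n)) => k k0.
  by rewrite /loop -mulmxA dmap_up //= -?gen_leg.
have [/val_inj->|ip] := eqVneq (i : nat) p; first by exists (loop r p h).
have apq : adj n p q by rewrite /adj /Dn_arrow; lia.
have aqp : adj n q p by rewrite /adj orbC.
have aps : adj n p s by rewrite /adj /Dn_arrow; lia.
have asp : adj n s p by rewrite /adj orbC.
have [/val_inj->|iq] := eqVneq (i : nat) q.
  exists (dmap r p q *m loop r p h *m dmap r q p) => k k0.
  rewrite -mulmxA -mulmxA dmap_gen // tgt_qp Tp ?double_gt0 // gen_q.
  by rewrite doubleS.
have -> : i = s by apply: val_inj; rewrite /= es; have := ltn_ord i; lia.
exists (dmap r p s *m loop r p h *m dmap r s p) => k k0.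
rewrite -mulmxA -mulmxA dmap_gen // tgt_sp Tp; last lia.
by rewrite gen_s //; congr (_ *m gen p _); lia.
Qed.

End Generators.

(** * Standard representations *)

Section GroupAction.

Variables (F : fieldType) (Q : quiver) (v w : qvert Q -> nat).
Implicit Types r : framed_rep F v w.

Lemma framed_rep_eq r r' :
  (forall i j (e : qarr i j), repX r e = repX r' e) ->
  (forall i j (e : qarr i j), repY r e = repY r' e) ->
  (forall i, repA r i = repA r' i) -> (forall i, repB r i = repB r' i) ->
  r = r'.
Proof.
case: r r' => X Y A B [X' Y' A' B'] /= eX eY eA eB.
have -> : X = X' by do 3!apply: functional_extensionality_dep => ?.
have -> : Y = Y' by do 3!apply: functional_extensionality_dep => ?.
have -> : A = A' by apply: functional_extensionality_dep.
by have -> : B = B' by apply: functional_extensionality_dep.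
Qed.

Lemma invmx_mulmx m (M N : 'M[F]_m) : M \in unitmx -> N \in unitmx ->
  invmx (M *m N) = invmx N *m invmx M.
Proof.
move=> uM uN; have uMN : M *m N \in unitmx by rewrite unitmx_mul uM.
apply: (can_inj (mulKmx uMN)).
by rewrite mulmxV // -mulmxA (mulmxA N) mulmxV // mul1mx mulmxV.
Qed.

Lemma gl_actM (g h : forall i, 'M[F]_(v i)) r :
  (forall i, g i \in unitmx) -> (forall i, h i \in unitmx) ->
  gl_act g (gl_act h r) = gl_act (fun i => g i *m h i) r.
Proof.
by move=> ug uh; apply: framed_rep_eq => * /=; rewrite ?invmx_mulmx // !mulmxA.
Qed.

Lemma gl_orbit_act (g : forall i, 'M[F]_(v i)) r : (forall i, g i \in unitmx) ->
  gl_orbit (gl_act g r) = gl_orbit r.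
Proof.
move=> ug; apply/seteqP; split=> _ [h uh ->].
  exists (fun i => h i *m g i); last by rewrite gl_actM.
  by move=> i; rewrite unitmx_mul uh ug.
exists (fun i => h i *m invmx (g i)).
  by move=> i; rewrite unitmx_mul uh unitmx_inv ug.
rewrite gl_actM // => [|i]; last by rewrite unitmx_mul uh unitmx_inv ug.
by congr gl_act; apply: functional_extensionality_dep => i; rewrite mulmxKV.
Qed.

End GroupAction.

Section LevelVectors.

Variable F : fieldType.

(* The basis vector attached to level [k >= 1]; it is [0] if there is none. *)
Definition level_vec m (k : nat) : 'cV[F]_m := \col_a (k == a.+1)%:R.

Lemma level_vec0 m : level_vec m 0 = 0.
Proof. by apply/colP => a; rewrite !mxE. Qed.

Lemma level_vec_gt m k : (m < k)%N -> level_vec m k = 0.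
Proof.
move=> ltmk; apply/colP => a; rewrite !mxE; case: eqP => // e.
by have := ltn_ord a; lia.
Qed.

Lemma level_vec_delta m (a : 'I_m) : level_vec m a.+1 = delta_mx a 0.
Proof.
by apply/colP => b; rewrite !mxE eqSS andbT -val_eqE eq_sym.
Qed.

Lemma level_vec_ext m m' (M N : 'M[F]_(m', m)) :
  (forall k, (0 < k <= m)%N -> M *m level_vec m k = N *m level_vec m k) ->
  M = N.
Proof.
move=> eMN; apply/matrixP => b a.
have /colP/(_ b) := eMN a.+1 (ltn_ord a).
by rewrite level_vec_delta -!colE !mxE.
Qed.

Lemma level_vec_full m (S : {vspace 'cV[F]_m}) :
  (forall k, (0 < k <= m)%N -> level_vec m k \in S) -> S = fullv.
Proof.
move=> lS; apply/eqP; rewrite eqEsubv subvf /=; apply/subvP => x _.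
rewrite [x]matrix_sum_delta; apply: rpred_sum => a _.
rewrite big_ord1; apply: rpredZ.
by rewrite -level_vec_delta lS //=.
Qed.

End LevelVectors.

Section StandardRep.

Variables (F : fieldType) (n : nat).
Hypothesis hn : (4 <= n)%N.
Variable v : 'I_n -> nat.

(* [v] counts, color by color, the elements of the order ideal consisting of the
   [d_{i+1,k}] with [1 <= k <= v i]. *)
Definition ideal_dims : Prop :=
  (forall (i : 'I_n) k, (0 < k <= v i)%N -> spin_index n i.+1 k) /\
  (forall (i j : 'I_n) k, adj n i j -> (0 < k)%N ->
     (0 < tgt n i j k <= v j)%N -> (k <= v i)%N).

Definition std_map (i j : 'I_n) : 'M[F]_(v j, v i) :=
  \matrix_(b, a) (tgt n i j a.+1 == b.+1)%:R.

Definition std_rep : @framed_rep F (Dn n) v (@delta_last n) :=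
  @FramedRep F (Dn n) v (@delta_last n)
    (fun i j _ => std_map i j) (fun i j _ => std_map j i)
    (fun i => \matrix_(a, _) (a == 0%N :> nat)%:R) (fun i => 0).

Lemma dmap_std (i j : 'I_n) : adj n i j -> dmap std_rep i j = std_map i j.
Proof.
case/orP => a.
  pose e : qarr (q := Dn n) i j := exist _ tt a.
  by rewrite (dmapX _ e).
pose e : qarr (q := Dn n) j i := exist _ tt a.
by rewrite (dmapY _ e).
Qed.

Lemma std_repA (s : 'I_n) : s = (n - 1)%N :> nat ->
  repA std_rep s *m const_mx 1 = level_vec F (v s) 1.
Proof.
move=> es; apply/colP => a; rewrite !mxE; under eq_bigr do rewrite !mxE mulr1.
by rewrite sumr_const card_ord (framing1 hn es) eqSS eq_sym.
Qed.

Lemma std_map_level (i j : 'I_n) k : (0 < k <= v i)%N ->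
  std_map i j *m level_vec F (v i) k = level_vec F (v j) (tgt n i j k).
Proof.
case: k => // k ltk; rewrite (level_vec_delta F (Ordinal ltk)) -colE.
by apply/colP => b; rewrite !mxE.
Qed.

Hypothesis idv : ideal_dims.

(** If the intermediate element lies outside the ideal, so does the element above it, and both sides
    vanish. *)
Lemma loop_std (i j : 'I_n) k : adj n i j -> (0 < k <= v i)%N ->
  loop std_rep i j *m level_vec F (v i) k =
  level_vec F (v i) (tgt n j i (tgt n i j k)).
Proof.
move=> aij hk; have k0 : (0 < k)%N by case/andP: hk.
have aji : adj n j i by rewrite /adj orbC.
rewrite /loop -mulmxA !dmap_std // std_map_level //.
have [t0|t0] := posnP (tgt n i j k).
  rewrite t0 level_vec0 mulmx0.
  suff -> : tgt n j i 0 = 0%N by rewrite level_vec0.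
  move: t0; case: (adjP hn (ltn_ord i) (ltn_ord j) aij) => ei ej ->;
    rewrite ?ei ?ej /tgt; split_ifs; lia.
have [le|gt] := leqP (tgt n i j k) (v j); first by rewrite std_map_level ?t0.
rewrite level_vec_gt // mulmx0; apply/esym.
have [->|t1] := posnP (tgt n j i (tgt n i j k)); first exact: level_vec0.
rewrite level_vec_gt // ltnNge; apply: contraTN gt => le.
by rewrite -leqNgt; apply: (idv.2 _ _ _ aji) => //; rewrite t1.
Qed.

(** Round trips along the long leg raise the level by one and cancel; at the branch vertex the
    cancelling trip goes through [n - 2] on odd levels and [n - 1] on even ones. At the end of the
    long leg level [k + 1] is missing, and on a short leg the trip is [0]. *)
Lemma moment_std i : moment_map std_rep i = 0.
Proof.
rewrite moment_mapE mulmx0 addr0; apply: level_vec_ext => k hk.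
have k0 : (0 < k)%N by case/andP: hk.
have lp : (n - 3 < n)%N by lia.
have lq : (n - 2 < n)%N by lia.
have ls : (n - 1 < n)%N by lia.
have l1 : (1 < n)%N by lia.
rewrite mul0mx mulmxBl !mulmx_suml.
under eq_bigr => j a do rewrite loop_std ?/adj ?a ?orbT //.
under [X in _ - X]eq_bigr => j a do rewrite loop_std ?/adj ?a ?orbT //.
have lti := ltn_ord i.
have [i0|ipos] := posnP i.
  rewrite big_pred0; last by move=> j /=; rewrite /Dn_arrow; lia.
  rewrite (big_pred1 (Ordinal l1)) => [|j]; last first.
    by rewrite /= -val_eqE /= /Dn_arrow; lia.
  have -> : tgt n (Ordinal l1) i (tgt n i (Ordinal l1) k) = k.+1.
    by rewrite /tgt /= i0; split_ifs; lia.
  rewrite level_vec_gt ?subr0 // ltnNge; apply/negP => le.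
  by have /(spin_indexP hn lti)[_] := idv.1 i k.+1 le; split_ifs; lia.
have lh : (i.-1 < n)%N by lia.
have [li|li] := ltnP i (n - 3).
  have li1 : (i.+1 < n)%N by lia.
  rewrite (big_pred1 (Ordinal lh)) => [|j]; last first.
    by rewrite /= -val_eqE /= /Dn_arrow; lia.
  rewrite (big_pred1 (Ordinal li1)) => [|j]; last first.
    by rewrite /= -val_eqE /= /Dn_arrow; lia.
  have -> : tgt n (Ordinal lh) i (tgt n i (Ordinal lh) k) = k.+1.
    by rewrite /tgt /=; split_ifs; lia.
  have -> : tgt n (Ordinal li1) i (tgt n i (Ordinal li1) k) = k.+1.
    by rewrite /tgt /=; split_ifs; lia.
  by rewrite subrr.
have [ip|ip] := eqVneq (i : nat) (n - 3)%N.
  rewrite (big_pred1 (Ordinal lh)) => [|j]; last first.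
    by rewrite /= -val_eqE /= /Dn_arrow; lia.
  rewrite (bigD1 (Ordinal lq)) /=; last by rewrite /Dn_arrow; lia.
  rewrite (big_pred1 (Ordinal ls)) => [|j]; last first.
    by rewrite /= -!val_eqE /= /Dn_arrow; lia.
  have -> : tgt n (Ordinal lh) i (tgt n i (Ordinal lh) k) = k.+1.
    by rewrite /tgt /=; split_ifs; lia.
  have -> : tgt n (Ordinal lq) i (tgt n i (Ordinal lq) k) =
            if odd k then k.+1 else 0%N.
    by rewrite /tgt /=; split_ifs; lia.
  have -> : tgt n (Ordinal ls) i (tgt n i (Ordinal ls) k) =
            if odd k then 0%N else k.+1.
    by rewrite /tgt /=; split_ifs; lia.
  by case: ifP => _; rewrite level_vec0 ?addr0 ?add0r subrr.
rewrite (big_pred1 (Ordinal lp)) => [|j]; last first.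
  by rewrite /= -val_eqE /= /Dn_arrow; lia.
rewrite big_pred0; last by move=> j /=; rewrite /Dn_arrow; lia.
have -> : tgt n (Ordinal lp) i (tgt n i (Ordinal lp) k) = 0%N.
  by rewrite /tgt /=; split_ifs; lia.
by rewrite level_vec0 subr0.
Qed.

(** Induction on the rank: each basis vector is the image of the one for a covered element, which is
    again in the ideal, down to the framing vector. *)
Lemma stable_std : stable std_rep.
Proof.
apply/stable_dmapP => S SA SZ i; apply: level_vec_full => k.
move: {2}(rank n i k) (erefl (rank n i k)) => d.
elim: d i k => [|d IHd] i k rkd /andP[k0 lek].
  have [ei ->] := rank0 hn (ltn_ord i) k0 rkd.
  by rewrite -std_repA.
have rk0 : (0 < rank n i k)%N by rewrite rkd.
have [pvn pl0 rkE aji te] := predP hn (ltn_ord i) k0 rk0.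
move: pvn pl0 rkE aji te; set l := pred_level n i k => pvn l0 rkE aji te.
have lel : (l <= v (Ordinal pvn))%N.
  by apply: (idv.2 (Ordinal pvn) i) => //=; rewrite te k0.
rewrite -te -(std_map_level (i := Ordinal pvn)) ?l0 // -dmap_std //.
apply: SZ => //; apply: IHd; rewrite ?l0 //=.
by move: rkE; rewrite rkd => -[].
Qed.

End StandardRep.

(** * Stable solutions are conjugate to standard ones *)

Section Uniqueness.

Variables (F : fieldType) (n : nat) (v : 'I_n -> nat).
Hypotheses (char_neq2 : 2%:R != 0 :> F) (hn : (4 <= n)%N).
Variable r : @framed_rep F (Dn n) v (@delta_last n).
Hypotheses (mom0 : forall i, moment_map r i = 0) (str : stable r).

Let lp : (n - 3 < n)%N. Proof. lia. Qed.
Let lq : (n - 2 < n)%N. Proof. lia. Qed.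
Let ls : (n - 1 < n)%N. Proof. lia. Qed.
Let p : 'I_n := Ordinal lp.
Let q : 'I_n := Ordinal lq.
Let s : 'I_n := Ordinal ls.

Let dgen (i j : 'I_n) k : adj n i j -> (0 < k)%N ->
  dmap r i j *m gen r i k = gen r j (tgt n i j k).
Proof. exact: (@dmap_gen _ _ _ _ hn s _ p q). Qed.

Let gen_inv (i : 'I_n) k : ~~ spin_index n i.+1 k -> gen r i k = 0.
Proof. exact: (@gen_invalid _ _ _ _ hn s _ p q). Qed.

Let gen_gt (i : 'I_n) k : (n < k)%N -> gen r i k = 0.
Proof.
move=> ltk; apply: gen_inv; apply/negP => /(spin_indexP hn (ltn_ord i))[_].
by have := ltn_ord i; split_ifs; lia.
Qed.

(** The spans of the generators contain the image of [A] and are closed under all arrows, so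
    stability applies. *)
Lemma gen_span (i : 'I_n) (S : {vspace 'cV[F]_(v i)}) :
  (forall k, gen r i k.+1 \in S) -> S = fullv.
Proof.
move=> genS.
(* Levels above [n] vanish by [gen_gt], so a finite list of vectors suffices. *)
pose T (j : 'I_n) := <<[seq gen r j k.+1 | k <- iota 0 n]>>%VS.
have genT (j : 'I_n) k : gen r j k \in T j.
  case: k => [|k]; first exact: mem0v.
  have [lekn|ltnk] := ltnP k n; last by rewrite gen_gt ?mem0v.
  by apply/memv_span/map_f; rewrite mem_iota.
have Tfull : T i = fullv.
  move/stable_dmapP: str; apply=> [j x|j j' x ajj].
    have [ej|nej] := eqVneq j s; last first.
      rewrite [repA r j]framing0 ?mul0mx ?mem0v //.
      by move: nej; rewrite -val_eqE /=; have := ltn_ord j; lia.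
    move: x; rewrite ej => x.
    have : gen r s 1 \in T s by [].
    rewrite gen_s1 //; move: x (repA r s); rewrite (framing1 hn (s := s)) //.
    move=> x A AT; have -> : x = x 0 0 *: const_mx 1.
      by apply/colP => a; rewrite !mxE mulr1 ord1.
    by rewrite -scalemxAr rpredZ.
  move/(@coord_span _ _ _ (in_tuple _)) => ->.
  rewrite mulmx_sumr; apply: rpred_sum => a _; rewrite -scalemxAr rpredZ //.
  have lta : (a < n)%N.
    by apply: leq_trans (ltn_ord a) _; rewrite size_map size_iota.
  rewrite (nth_map 0%N) ?size_iota // nth_iota // dgen //.
  exact: genT.
apply/eqP; rewrite -Tfull eqEsubv Tfull subvf /= -Tfull.
by apply/span_subvP => _ /mapP[k _ ->].
Qed.

(** The change of basis carrying the standard representation to [r]. *)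
Definition gen_mx (i : 'I_n) : 'M[F]_(v i) :=
  \matrix_(a, b) gen r i b.+1 a 0.

Lemma gen_basis (i : 'I_n) :
  (forall k, (gen r i k.+1 == 0) = (v i <= k)%N) /\ gen_mx i \in unitmx.
Proof.
have [T TE] : exists T : 'M[F]_(v i),
    forall k, (0 < k)%N -> T *m gen r i k = gen r i k.+1.
  exact: (@gen_shift _ _ _ _ hn s _ p q).
apply: (@shift_basis _ _ T (fun k => gen r i k.+1) _ n).
- by move=> k; rewrite TE.
- exact: gen_gt.
- exact: gen_span.
Qed.

Lemma gen_mx_level (i : 'I_n) k :
  gen_mx i *m level_vec F (v i) k = gen r i k.
Proof.
case: k => [|k]; first by rewrite level_vec0 mulmx0.
have [lek|ltk] := leqP (v i) k.
  rewrite level_vec_gt // mulmx0; apply/esym/eqP.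
  by rewrite (gen_basis i).1.
rewrite (level_vec_delta _ (Ordinal ltk)) -colE.
by apply/colP => a; rewrite !mxE.
Qed.

(** For [k >= 1], [gen r i k] is nonzero exactly when [k <= v i]. Nonzero generators have valid
    indices, and a nonzero image comes from a nonzero vector. *)
Lemma stable_ideal_dims : ideal_dims v.
Proof.
have gen0 (i : 'I_n) k : (0 < k)%N -> (gen r i k == 0) = (v i < k)%N.
  by case: k => // k _; rewrite (gen_basis i).1.
split=> [i k /andP[k0 lek]|i j k aij k0 /andP[t0 let_]].
  by apply: contraTT lek => /gen_inv/eqP; rewrite gen0 // ltnNge.
rewrite leqNgt -gen0 //; apply: contraTN let_ => /eqP gk.
by rewrite -ltnNge -gen0 // -dgen // gk mulmx0.
Qed.

(** Both sides are compared on basis vectors: arrows agree by [dmap_gen], [A] by [gen_s1], and [B]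
    vanishes by [repB_gen]. *)
Lemma stable_std_act : r = @gl_act F (Dn n) v _ gen_mx (std_rep F v).
Proof.
have ug i : gen_mx i \in unitmx by have [] := gen_basis i.
have dE (i j : 'I_n) : adj n i j ->
    dmap r i j = gen_mx j *m std_map F v i j *m invmx (gen_mx i).
  move=> aij; apply: (can_inj (mulmxK (ug i))); rewrite mulmxKV //.
  apply: level_vec_ext => k hk; rewrite -!mulmxA gen_mx_level.
  by rewrite std_map_level // gen_mx_level dgen //; case/andP: hk.
apply: framed_rep_eq => [i j e|i j e|i|i] /=.
- by rewrite -dmapX dE //; case: e => -[]/= a; rewrite /adj a.
- by rewrite -dmapY dE //; case: e => -[]/= a; rewrite /adj a orbT.
- have [ei|nei] := eqVneq i s; last first.
    rewrite [LHS]framing0 1?[RHS]framing0 //.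
    1,2: by move: nei (ltn_ord i); rewrite -val_eqE /=; lia.
  have cancel1 w (M N : 'M[F]_(v s, w)) : w = 1%N ->
      M *m const_mx 1 = N *m const_mx 1 :> 'cV_(v s) -> M = N.
    move=> w1; subst w => eMN; apply/matrixP => a b.
    have /(congr1 (fun x : 'cV_ _ => x a 0)) := eMN.
    by rewrite !mxE !big_ord1 !mxE !mulr1 !ord1.
  rewrite ei; apply: cancel1; first exact: (framing1 hn).
  by rewrite -mulmxA std_repA // gen_mx_level gen_s1.
- rewrite mul0mx; have [ei|nei] := eqVneq i s; last first.
    apply: trmx_inj; rewrite trmx0; apply: framing0.
    by move: nei (ltn_ord i); rewrite -val_eqE /=; lia.
  apply: (can_inj (mulmxK (ug i))); rewrite mul0mx.
  apply: level_vec_ext => k hk; rewrite -!mulmxA gen_mx_level mul0mx ei.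
  exact: (@repB_gen _ _ _ _ hn s _ p q).
Qed.

End Uniqueness.

(** * Order ideals *)

Section Posets.

Variable n : nat.
Hypothesis hn : (4 <= n)%N.
Local Open Scope nat_scope.
Implicit Types (d : spin n) (i j : 'I_n) (P : {set spin n}).

Lemma spin_ord d : {i : 'I_n | (val d).1 = i.+1 :> nat}.
Proof.
have hi : spin_index n (val d).1 (val d).2 := valP d.
have lt1 : (val d).1.-1 < n by have := ltn_ord (val d).1; lia.
by exists (Ordinal lt1); move: hi; rewrite /spin_index /=; lia.
Qed.

Lemma spin_inj d d' : (val d).1 = (val d').1 :> nat ->
  (val d).2 = (val d').2 :> nat -> d = d'.
Proof.
move=> e1 e2; apply: val_inj; move: e1 e2.
by case: (val d) (val d') => [a b] [a' b'] /= /val_inj -> /val_inj ->.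
Qed.

Lemma spin_of_index i k : spin_index n i.+1 k ->
  exists d, (val d).1 = i.+1 :> nat /\ (val d).2 = k :> nat.
Proof.
move=> h; have lti := ltn_ord i.
have ltk : k < n.+1 by have [_] := spin_indexP hn lti h; split_ifs; lia.
have lti1 : i.+1 < n.+1 by [].
by exists (exist _ (Ordinal lti1, Ordinal ltk) h).
Qed.

Lemma spin_level_gt0 d : 0 < (val d).2.
Proof.
have [i ei] := spin_ord d; have := valP d; rewrite /= ei.
by case/(spin_indexP hn (ltn_ord i)).
Qed.

(** Within one color the level determines the element. *)
Lemma card_levels i c (A : {pred spin n}) :
  (forall d, d \in A -> (val d).1 = i.+1 :> nat /\ (val d).2 <= c) ->
  (forall k, 0 < k <= c -> exists2 d, d \in A & (val d).2 = k :> nat) ->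
  #|A| = c.
Proof.
move=> hA hc.
have /choice[f fP] : forall k : 'I_c, exists d, d \in A /\ (val d).2 = k.+1 :> nat.
  by move=> k; have [|d dA dk] := hc k.+1; [exact: (ltn_ord k)|exists d].
have finj : injective f.
  move=> k k' e; apply: val_inj; have [_] := fP k; rewrite e (fP k').2.
  by case.
rewrite -[RHS]card_ord -(card_imset predT finj); apply: eq_card => d.
apply/idP/imsetP => [dA|[k _ ->]]; last by have [] := fP k.
have [ei le] := hA d dA; have d0 := spin_level_gt0 d.
have ltc : (val d).2.-1 < c by rewrite prednK.
exists (Ordinal ltc) => //; have [fA f2] := fP (Ordinal ltc).
by apply: spin_inj; rewrite ?f2 ?prednK // ei (hA _ fA).1.
Qed.

Definition ideal_of (v : 'I_n -> nat) : {set spin n} :=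
  [set d : spin n |
    [exists i : 'I_n, ((val d).1 == i.+1 :> nat) && ((val d).2 <= v i)]].

Lemma mem_ideal_of (v : 'I_n -> nat) d i : (val d).1 = i.+1 :> nat ->
  (d \in ideal_of v) = ((val d).2 <= v i).
Proof.
move=> ei; rewrite inE; apply/existsP/idP => [[j]|le].
  by rewrite ei eqSS => /andP[/eqP/val_inj ->].
by exists i; rewrite ei eqxx.
Qed.

Lemma color_count_ideal_of v : ideal_dims v -> color_count (ideal_of v) = v.
Proof.
move=> idv; apply: funext => i; apply: (@card_levels i) => [d|k hk].
  rewrite inE /spin_color => /andP[dP /eqP ei].
  by split=> //; rewrite -(mem_ideal_of v ei).
have [d [ei ek]] := spin_of_index (idv.1 i k hk).
exists d => //; rewrite inE /spin_color (mem_ideal_of v ei) ei eqxx ek andbT.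
by case/andP: hk.
Qed.

Lemma ideal_of_poset v : ideal_dims v -> Dn_posets (ideal_of v).
Proof.
move=> idv d d' dP /connectP[t pt et]; elim: t d' pt et => [|e t IHt] d' /=.
  by move=> _ <-.
move=> /andP[g pt] et; have {pt et IHt} eP := IHt e pt et.
have [i ei] := spin_ord e; have [j ej] := spin_ord d'.
move: eP; rewrite (mem_ideal_of v ei) (mem_ideal_of v ej) => le.
have v1 : spin_index n j.+1 (val d').2 by have := valP d'; rewrite /= ej.
have v2 : spin_index n i.+1 (val e).2 by have := valP e; rewrite /= ei.
move: g; rewrite ej ei => /(spin_gen_tgt hn (ltn_ord j) (ltn_ord i) v1 v2)[a el].
by apply: (idv.2 j i _ a (spin_level_gt0 d')); rewrite -el le spin_level_gt0.
Qed.

Lemma initial_segment (Q : pred nat) : (forall k, Q k -> 0 < k <= n) ->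
  (forall k, 0 < k -> Q k.+1 -> Q k) ->
  exists c, forall k, Q k = (0 < k <= c).
Proof.
move=> Qb Qd; have ex : exists k, ~~ Q k.+1.
  by exists n; apply/negP => /Qb; rewrite ltnn.
case: (ex_minnP ex) => c nQc cmin; exists c => k.
have [->|k0] := posnP k; first by apply/negP => /Qb.
have [lek|ltk] := leqP k c.
  apply: contraT => nQk; have := cmin k.-1.
  by rewrite prednK // => /(_ nQk); lia.
apply/negP => Qk; move: nQc; apply/negP; rewrite negbK.
rewrite -(subnK ltk) in Qk; elim: (k - c.+1) Qk => // t IHt.
by rewrite addSn => /Qd Qt; apply: IHt; apply: Qt; rewrite addnS.
Qed.

Section Ideal.

Variable P : {set spin n}.
Hypothesis PD : Dn_posets P.

(** Membership in [P] by vertex and level, false for pairs that index no element. *)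
Let Q (i : 'I_n) (k : nat) : bool :=
  [exists d in P, ((val d).1 == i.+1 :> nat) && ((val d).2 == k :> nat)].

Let QP d i : (val d).1 = i.+1 :> nat -> Q i (val d).2 = (d \in P).
Proof.
move=> ei; apply/exists_inP/idP => [[e eP]|dP].
  case/andP=> /eqP e1 /eqP e2; suff <- : e = d by [].
  by apply: spin_inj; rewrite ?e1 ?ei ?e2.
by exists d; rewrite // ei !eqxx.
Qed.

Let Q_index i k : Q i k -> spin_index n i.+1 k.
Proof. by case/exists_inP => d _ /andP[/eqP <- /eqP <-]; apply: (valP d). Qed.

Let Q_tgt i j k : adj n i j -> 0 < k -> Q j (tgt n i j k) -> Q i k.
Proof.
move=> a k0 Qj;
have [v1 g] := tgt_gen hn (ltn_ord i) (ltn_ord j) a k0 (Q_index Qj).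
have [d [ei ek]] := spin_of_index v1.
rewrite -ek (QP ei); case/exists_inP: Qj => e eP /andP[/eqP ej /eqP el].
by apply: (PD eP); apply: connect1; rewrite ei ek ej el.
Qed.

Let Q_step i j k l : adj n i j -> 0 < k -> tgt n i j k = l -> Q j l -> Q i k.
Proof. by move=> a k0 <-; apply: Q_tgt. Qed.

(** [d_{i+1,k+1}] lies above [d_{i,k}], which lies above [d_{i+1,k}]. *)
Let Q_pred_leg i k : i <= n - 3 -> 0 < k -> Q i k.+1 -> Q i k.
Proof.
move=> li k0 Qk; have lti := ltn_ord i; have [i0|i0] := posnP i.
  by have /(spin_indexP hn lti)[_] := Q_index Qk; split_ifs; lia.
have lt_h : i.-1 < n by lia.
have Qh : Q (Ordinal lt_h) k.
  apply: Q_step Qk => //; first by rewrite /adj /Dn_arrow /=; lia.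
  by rewrite /tgt /=; split_ifs; lia.
apply: Q_step Qh => //; first by rewrite /adj /Dn_arrow /=; lia.
by rewrite /tgt /=; split_ifs; lia.
Qed.

(** From a short leg, descend to the branch vertex, then one level there, then back to the same
    leg. *)
Let Q_pred i k : 0 < k -> Q i k.+1 -> Q i k.
Proof.
move=> k0 Qk; have lti := ltn_ord i.
have lt_p : n - 3 < n by lia.
pose p := Ordinal lt_p.
have [li|li] := leqP i (n - 3); first exact: Q_pred_leg.
have api : adj n p i by rewrite /adj /Dn_arrow /=; lia.
have aip : adj n i p by rewrite /adj orbC.
have down l : 0 < l -> Q p l.+1 -> Q p l by apply: Q_pred_leg.
have [iq|iq] := eqVneq (i : nat) (n - 2).
  have Qp : Q p k.*2.+1.
    by apply: Q_step Qk => //; rewrite /tgt /=; split_ifs; lia.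
  apply: (Q_step aip k0 _ (down _ _ Qp)); last by rewrite double_gt0.
  by rewrite /tgt /=; split_ifs; lia.
have Qp : Q p k.*2.
  by apply: Q_step Qk => //; [lia|rewrite /tgt /=; split_ifs; lia].
have e2 : k.*2 = k.*2.-1.+1 by lia.
rewrite e2 in Qp; apply: (Q_step aip k0 _ (down _ _ Qp)); last lia.
by rewrite /tgt /=; split_ifs; lia.
Qed.

Let segments : exists c : 'I_n -> nat, forall i k, Q i k = (0 < k <= c i).
Proof.
suff /choice : forall i, exists c, forall k, Q i k = (0 < k <= c).
  by move=> [c cP]; exists c.
move=> i; apply: (@initial_segment (Q i)).
2: exact: Q_pred.
move=> k /Q_index /(spin_indexP hn (ltn_ord i)).
by have := ltn_ord i; split_ifs; lia.
Qed.

Let Q_count i k : Q i k = (0 < k <= color_count P i).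
Proof.
have [c cP] := segments; rewrite cP; congr (_ < _ <= _); apply/esym.
apply: (@card_levels i) => [d|l hl].
  rewrite inE /spin_color => /andP[dP /eqP ei]; split=> //.
  by move: dP; rewrite -(QP ei) cP => /andP[].
move: hl; rewrite -cP => /exists_inP[d dP /andP[/eqP e1 /eqP e2]].
by exists d => //; rewrite inE dP /spin_color e1 eqxx.
Qed.

Lemma poset_ideal_dims : ideal_dims (color_count P).
Proof.
split=> [i k|i j k a k0]; rewrite -Q_count; first exact: Q_index.
by move/(Q_tgt a k0); rewrite Q_count => /andP[].
Qed.

Lemma ideal_of_color_count : ideal_of (color_count P) = P.
Proof.
apply/setP => d; have [i ei] := spin_ord d.
by rewrite (mem_ideal_of _ ei) -(QP ei) Q_count spin_level_gt0.
Qed.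

End Ideal.
End Posets.

(** * Nonempty varieties are points *)

Lemma krull_dim_point (T : Type) (cl : set (set T)) (o : T) :
  cl [set o]%classic -> (forall Z, cl Z -> Z `<=` [set o]%classic)%classic ->
  has_krull_dim cl 0.
Proof.
move=> clo sub; split=> [|[//|m] [Z [irr lt]]].
  exists (fun=> [set o]%classic); split=> // k _; split=> // [|Z1 Z2 _ _ Z12].
    by exists o.
  by have [] := Z12 o erefl => Zo; [left|right] => _ ->.
(* Of two nonempty subsets of one point, neither is strictly contained in the other. *)
have [cl0 [x Zx] _] := irr 0%N isT.
have [cl1 _ _] := irr 1%N isT.
have [_ []] := lt 0%N isT; move=> y Z1y.
by rewrite (sub _ cl1 y Z1y) -(sub _ cl0 x Zx).
Qed.

Section Points.

Variables (F : fieldType) (n : nat) (v : 'I_n -> nat).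
Hypotheses (char_neq2 : 2%:R != 0 :> F) (hn : (4 <= n)%N).
Local Notation variety := (@quiver_variety F (Dn n) v (@delta_last n)).
Local Open Scope classical_set_scope.

Lemma std_mem_stable_locus : ideal_dims v ->
  stable_locus (std_rep F v).
Proof. by move=> idv; split; [move=> i; apply: moment_std|apply: stable_std]. Qed.

Lemma quiver_variety_point : variety !=set0 ->
  ideal_dims v /\ variety = [set gl_orbit (std_rep F v)].
Proof.
move=> [_ [r [mom0 str] _]].
have idv := stable_ideal_dims char_neq2 hn mom0 str; split=> //.
apply/seteqP; split=> [_ [r' [mom0' str'] <-]|_ ->].
  rewrite (stable_std_act char_neq2 hn mom0' str') /=.
  rewrite gl_orbit_act // => i.
  by have [] := gen_basis char_neq2 hn mom0' str' i.
by exists (std_rep F v) => //; apply: std_mem_stable_locus.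
Qed.

Lemma quiver_variety_nonempty : variety !=set0 <-> ideal_dims v.
Proof.
split=> [/quiver_variety_point[]//|idv].
exists (gl_orbit (std_rep F v)); exists (std_rep F v) => //.
exact: std_mem_stable_locus.
Qed.

Lemma quiver_variety_dim0 : variety !=set0 ->
  has_krull_dim (@zariski_closed F (Dn n) v (@delta_last n)) 0.
Proof.
move=> /quiver_variety_point[idv vE].
apply: (@krull_dim_point _ _ (gl_orbit (std_rep F v))).
  (* The empty family of equations cuts out the whole variety. *)
  rewrite -vE; split=> //; exists set0 => // r rs; split=> // _.
  by exists r.
by move=> Z [sub _]; rewrite -vE.
Qed.

End Points.

Local Open Scope classical_set_scope.

Theorem theorem4p7 (R : realType) (n : nat) (hn : (4 <= n)%N) :
  set_bij (@Dn_posets n)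
          [set v : 'I_n -> nat | Dn_variety R v !=set0]
          (@color_count n)
  /\
  (forall v : 'I_n -> nat,
     Dn_variety R v !=set0 -> has_krull_dim (Dn_variety_closed R v) 0).
Proof.
have two : 2%:R != 0 :> R[i] by rewrite Num.Theory.pnatr_eq0.
split; last by move=> v; apply: quiver_variety_dim0.
split=> [P PD|P P' |v /= /(quiver_variety_nonempty _ two hn) idv].
- by apply/(quiver_variety_nonempty _ two hn); apply: poset_ideal_dims.
(* An ideal is recovered from its color counts by [ideal_of]. *)
- rewrite !inE => PD P'D e.
  by rewrite -(ideal_of_color_count hn PD) e ideal_of_color_count.
- exists (ideal_of v); first exact: ideal_of_poset.
  exact: color_count_ideal_of.
Qed.
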